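(* Let $f\in C^\infty(\mathbb{R})$ have no zeros, let $(D,g^D)$ be the associated warped product distribution on $\mathbb{R}\times H_3$ (see context), and let $c_0\in\mathbb{R}$. Then $(D,g^D)$ is Einstein with Einstein constant $c_0$ if and only if one of the following holds for some real constants $c_1,c_2$: (1) $c_0=0$ and $f(t)=c_1$; (2) $c_0>0$ and $f(t)=c_1e^{\sqrt{\frac{c_0}{2}}\,t}$ or $f(t)=c_2e^{-\sqrt{\frac{c_0}{2}}\,t}$.
   Context: $H_3$ is the Heisenberg group: $\mathbb{R}^3$ with coordinates $(x,y,z)$ and Riemannian metric $g_{H_3}=dx^2+dy^2+(dz+\frac12(y\,dx-x\,dy))^2$, with orthonormal frame $e_1=\partial_x-\frac y2\partial_z$, $e_2=\partial_y+\frac x2\partial_z$, $e_3=\partial_z$, satisfying $[e_1,e_2]=e_3$, $[e_1,e_3]=[e_2,e_3]=0$. Let $D^1=\mathrm{span}\{e_1,e_2\}$ and $D^{1,\bot}=\mathrm{span}\{e_3\}$, with induced metrics $g^{D^1},g^{D^{1,\bot}}$. On $M=\mathbb{R}\times H_3$ with projections $\pi_1,\pi_2$ onto the factors, put $$g^M_f=\pi_1^*dt^2\oplus f^2\pi_2^*g^{D^1}\oplus\pi_2^*g^{D^{1,\bot}},\quad D=\pi_1^*(T\mathbb{R})\oplus\pi_2^*D^1=\mathrm{span}\{\partial_t,e_1,e_2\},\quad g^D=\pi_1^*dt^2\oplus f^2\pi_2^*g^{D^1}.$$ $(D,g^D)$ is called the warped product distribution on $M$. Let $\nabla^f$ be the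 Levi-Civita connection of $g^M_f$, $D^\bot$ the orthogonal complement of $D$, $\pi^D$ and $\pi^{D^\bot}$ the orthogonal projections, $[X,Y]^D=\pi^D[X,Y]$, $[X,Y]^{D^\bot}=\pi^{D^\bot}[X,Y]$. For $X,Y,Z\in\Gamma(D)$: $\nabla^D_XY=\pi^D(\nabla^f_XY)$ and $$R^D(X,Y)Z=\nabla^D_X\nabla^D_YZ-\nabla^D_Y\nabla^D_XZ-\nabla^D_{[X,Y]^D}Z-\pi^D[[X,Y]^{D^\bot},Z].$$ The Ricci tensor is $\mathrm{Ric}^D(X,Y)=\sum_{k=1}^3g^D(R^D(X,E_k)Y,E_k)$ for an orthonormal basis $E_1,E_2,E_3$ of $(D,g^D)$ (note this sign convention). $(D,g^D)$ is Einstein with Einstein constant $c_0$ if $\mathrm{Ric}^D(X,Y)=c_0g^D(X,Y)$ for all $X,Y\in\Gamma(D)$. *)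

(* Defs.v *)
From mathcomp Require Import all_boot all_order all_algebra.
From mathcomp Require Import all_classical all_reals all_analysis.

Set Implicit Arguments.
Unset Strict Implicit.
Unset Printing Implicit Defensive.

Import Order.TTheory GRing.Theory Num.Theory.
Import numFieldNormedType.Exports.

Local Open Scope classical_set_scope.
Local Open Scope ring_scope.

Definition smooth1 (R : realType) (f : R -> R) : Prop :=
  forall (k : nat) (t : R), derivable (f^`(k))%classic t 1.

(* Calculus on R^n. Tangent vectors and vector fields are given by their
   components in the coordinate basis; tensors and distributions on R^n are
   functions of a base point. *)
Section Calculus.
Context {R : realType} {n : nat}.
Local Notation V := 'rV[R]_n.+1.

Fixpoint Ck (k : nat) (phi : V -> R) : Prop :=
  match k with
  | 0%N => continuous phi
  | k'.+1 => (forall p, differentiable phi p) /\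
             (forall v, Ck k' (fun p => 'D_v phi p))
  end.

Definition smooth (phi : V -> R) : Prop := forall k, Ck k phi.

Definition vector_field (X : V -> V) : Prop :=
  forall i, smooth (fun p => X p 0 i).

Definition dir (X : V -> V) (phi : V -> R) : V -> R :=
  fun p => 'D_(X p) phi p.

Definition bracket (X Y : V -> V) : V -> V := fun p =>
  \row_i (dir X (fun q => Y q 0 i) p - dir Y (fun q => X q 0 i) p).

(* Nothing is required of [nabla] outside the smooth vector fields. *)
Record is_levi_civita (g : V -> V -> V -> R)
    (nabla : (V -> V) -> (V -> V) -> V -> V) : Prop := {
  lc_smooth : forall X Y, vector_field X -> vector_field Y ->
    vector_field (nabla X Y);
  lc_addl : forall X X' Y,
    vector_field X -> vector_field X' -> vector_field Y ->
    nabla (fun p => X p + X' p) Y = (fun p => nabla X Y p + nabla X' Y p);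
  lc_scalel : forall phi X Y,
    smooth phi -> vector_field X -> vector_field Y ->
    nabla (fun p => phi p *: X p) Y = (fun p => phi p *: nabla X Y p);
  lc_addr : forall X Y Y',
    vector_field X -> vector_field Y -> vector_field Y' ->
    nabla X (fun p => Y p + Y' p) = (fun p => nabla X Y p + nabla X Y' p);
  lc_leibniz : forall phi X Y,
    smooth phi -> vector_field X -> vector_field Y ->
    nabla X (fun p => phi p *: Y p) =
    (fun p => dir X phi p *: Y p + phi p *: nabla X Y p);
  lc_torsion_free : forall X Y, vector_field X -> vector_field Y ->
    (fun p => nabla X Y p - nabla Y X p) = bracket X Y;
  lc_metric : forall X Y Z,
    vector_field X -> vector_field Y -> vector_field Z ->
    dir X (fun p => g p (Y p) (Z p)) =
    (fun p => g p (nabla X Y p) (Z p) + g p (Y p) (nabla X Z p))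
}.

Definition levi_civita (g : V -> V -> V -> R) :
    (V -> V) -> (V -> V) -> V -> V :=
  get [set nabla | is_levi_civita g nabla].

(* The orthogonal projection of [u] onto the row space of [U] with respect to
   the inner product [b]. *)
Definition oproj (b : V -> V -> R) (U : 'M[R]_n.+1) (u : V) : V :=
  get [set w : V | (w <= U)%MS /\ forall v : V, (v <= U)%MS -> b (u - w) v = 0].

Definition section (D : V -> 'M[R]_n.+1) (X : V -> V) : Prop :=
  vector_field X /\ forall p, (X p <= D p)%MS.

End Calculus.

(* H_3 is 'rV[R]_3 with coordinates (x, y, z) = (q 0 0, q 0 1, q 0 2). *)
Section Heisenberg.
Context {R : realType}.
Local Notation H3 := 'rV[R]_3.

Definition vec3 (a b c : R) : H3 := \row_i [:: a; b; c]`_i.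

(* The value on [u] of the 1-form dz + (y dx - x dy) / 2. *)
Definition theta (q u : H3) : R :=
  u 0 2 + 2^-1 * (q 0 1 * u 0 0 - q 0 0 * u 0 1).

Definition gH3 (q u v : H3) : R :=
  u 0 0 * v 0 0 + u 0 1 * v 0 1 + theta q u * theta q v.

Definition e1 (q : H3) : H3 := vec3 1 0 (- (q 0 1 / 2)).
Definition e2 (q : H3) : H3 := vec3 0 1 (q 0 0 / 2).
Definition e3 (q : H3) : H3 := vec3 0 0 1.

Definition D1 (q : H3) : 'M[R]_3 := (e1 q + e2 q)%MS.
Definition D1perp (q : H3) : 'M[R]_3 := <<e3 q>>%MS.

(* The induced metrics, extended by 0 on the orthogonal complement. *)
Definition gD1 (q u v : H3) : R :=
  gH3 q (oproj (gH3 q) (D1 q) u) (oproj (gH3 q) (D1 q) v).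
Definition gD1perp (q u v : H3) : R :=
  gH3 q (oproj (gH3 q) (D1perp q) u) (oproj (gH3 q) (D1perp q) v).

End Heisenberg.

(* M = R x H_3 is 'rV[R]_(1 + 3). Both projections are linear in these
   coordinates, so that [pi1] and [pi2] are also their own differentials. *)
Section WarpedProduct.
Context {R : realType}.
Local Notation M := 'rV[R]_(1 + 3).

Definition pi1 (p : M) : R := lsubmx p 0 0.
Definition pi2 (p : M) : 'rV[R]_3 := rsubmx p.

Definition partial_t (p : M) : M := row_mx 1 0.
Definition e1M (p : M) : M := row_mx 0 (e1 (pi2 p)).
Definition e2M (p : M) : M := row_mx 0 (e2 (pi2 p)).

Definition D (p : M) : 'M[R]_(1 + 3) := (partial_t p + e1M p + e2M p)%MS.

Variable f : R -> R.

Definition gD (p u v : M) : R :=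
  pi1 u * pi1 v + f (pi1 p) ^+ 2 * gD1 (pi2 p) (pi2 u) (pi2 v).

Definition gM (p u v : M) : R :=
  gD p u v + gD1perp (pi2 p) (pi2 u) (pi2 v).

Definition piD (X : M -> M) : M -> M := fun p => oproj (gM p) (D p) (X p).
Definition piDperp (X : M -> M) : M -> M := fun p => X p - piD X p.

Definition nablaD (X Y : M -> M) : M -> M := piD (levi_civita gM X Y).

Definition RD (X Y Z : M -> M) : M -> M := fun p =>
  nablaD X (nablaD Y Z) p - nablaD Y (nablaD X Z) p
  - nablaD (piD (bracket X Y)) Z p
  - piD (bracket (piDperp (bracket X Y)) Z) p.

Definition orthonormal_frame (E : 'I_3 -> M -> M) : Prop :=
  (forall k, section D (E k)) /\
  forall p i j, gD p (E i p) (E j p) = (i == j)%:R.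

Definition RicD (E : 'I_3 -> M -> M) (X Y : M -> M) (p : M) : R :=
  \sum_k gD p (RD X (E k) Y p) (E k p).

(* [RicD] does not depend on the choice of the orthonormal frame. *)
Definition einstein (c0 : R) : Prop :=
  forall E, orthonormal_frame E ->
  forall X Y, section D X -> section D Y ->
  forall p, RicD E X Y p = c0 * gD p (X p) (Y p).

End WarpedProduct.

(* Main.v *)
Require Import Defs.
From mathcomp Require Import all_boot all_order all_algebra.
From mathcomp Require Import all_classical all_reals all_analysis.
From mathcomp Require Import ring lra.

Set Implicit Arguments.
Unset Strict Implicit.
Unset Printing Implicit Defensive.

Import Order.TTheory GRing.Theory Num.Theory.
Import numFieldNormedType.Exports.

Local Open Scope classical_set_scope.
Local Open Scope ring_scope.

(** Brackets of sections of the distribution leave it only through [e1, e2] =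
    [e3], and [e3] commutes with the whole frame. The projection of the
    Levi-Civita connection to the distribution therefore has, in the frame
    [partial_t], [e1], [e2], the same coefficients as the Levi-Civita
    connection of the warped product [dt^2 + f^2 (dx^2 + dy^2)] of the line
    with the flat plane ([coef_nablaD]). The last term in the definition of the
    curvature removes the derivative along [e3] that is left over from the
    commutator of the second derivatives, so that the curvature is also the one
    of this warped product ([coef_RD]). Its Ricci tensor, in the sign
    convention in use, is [2 (f'' / f) dt^2 + (f f'' + f'^2) (dx^2 + dy^2)]
    ([RicDE]). Hence the Einstein condition is the pair of equations

      [2 f'' = c0 f]   and   [f f'' + f'^2 = c0 f^2]

    ([einsteinP]), which force [f'^2 = f f'']. Then [f' / f] is a constant [k]
    with [2 k^2 = c0], and [f] is a multiple of [exp (k t)] ([warp_ode]):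
    constant when [c0 = 0], and otherwise [k] is one of the two square roots of
    [c0 / 2].

    Orthogonal projections and the Levi-Civita connection are defined by
    choice. Positive definiteness makes the former explicit ([oproj_eq]). For
    the latter, the connection given by Koszul's formula in the frame is shown
    to qualify ([frame_connection_levi_civita]), and any two connections that
    qualify are shown to agree on smooth fields ([levi_civita_unique]). The
    analytic input is that smooth functions are stable under the operations in
    these formulas and that second derivatives are symmetric ([derive_comm]).
    *)

(** * Smooth functions and vector fields *)

Section SmoothFunctions.
Context {R : realType} {n : nat}.
Local Notation V := 'rV[R]_n.+1.
Implicit Types (phi psi : V -> R) (X Y : V -> V) (p v : V).

Lemma derive_add phi psi p v : differentiable phi p -> differentiable psi p ->
  'D_v (fun q => phi q + psi q) p = 'D_v phi p + 'D_v psi p.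
Proof. by move=> dphi dpsi; apply: deriveD; exact: diff_derivable. Qed.

Lemma derive_mul phi psi p v : differentiable phi p -> differentiable psi p ->
  'D_v (fun q => phi q * psi q) p = 'D_v phi p * psi p + phi p * 'D_v psi p.
Proof.
move=> dphi dpsi; rewrite [LHS]deriveM; do ?exact: diff_derivable.
by rewrite /GRing.scale /= addrC [psi p * _]mulrC.
Qed.

Lemma derive_inv phi p v : differentiable phi p -> phi p != 0 ->
  'D_v (fun q => (phi q)^-1) p = - 'D_v phi p * ((phi p)^-1 * (phi p)^-1).
Proof.
move=> dphi phi0; rewrite deriveV //; last exact: diff_derivable.
by rewrite /GRing.scale /= -exprVn expr2; ring.
Qed.

Lemma eq_Ck k phi psi : phi =1 psi -> Ck k phi -> Ck k psi.
Proof. by move=> /funext ->. Qed.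

Lemma Ck_cst k (c : R) : Ck k (fun _ : V => c).
Proof.
elim: k c => [|k IH] c /=; first by move=> p; exact: cst_continuous.
split=> [p|v]; first exact: differentiable_cst.
by apply: (eq_Ck _ (IH 0)) => p; rewrite derive_cst.
Qed.

Lemma CkSW k phi : Ck k.+1 phi -> Ck k phi.
Proof.
elim: k phi => [|k IH] phi [dphi Dphi].
  by move=> p; exact: differentiable_continuous.
by split=> // v; apply: IH; exact: Dphi.
Qed.

Lemma CkD k phi psi : Ck k phi -> Ck k psi -> Ck k (fun p => phi p + psi p).
Proof.
elim: k phi psi => [|k IH] phi psi /=.
  by move=> cphi cpsi p; apply: continuousD; [exact: cphi|exact: cpsi].
move=> [dphi Dphi] [dpsi Dpsi]; split=> [p|v]; first exact: differentiableD.
apply: (eq_Ck _ (IH _ _ (Dphi v) (Dpsi v))) => p.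
by rewrite derive_add.
Qed.

Lemma CkM k phi psi : Ck k phi -> Ck k psi -> Ck k (fun p => phi p * psi p).
Proof.
elim: k phi psi => [|k IH] phi psi.
  by move=> cphi cpsi p; apply: continuousM; [exact: cphi|exact: cpsi].
move=> hphi hpsi; have [dphi Dphi] := hphi; have [dpsi Dpsi] := hpsi.
split=> [p|v]; first exact: differentiableM.
apply: (@eq_Ck _ (fun p => 'D_v phi p * psi p + phi p * 'D_v psi p)).
  by move=> p; rewrite derive_mul.
by apply: CkD; apply: IH; first [exact: Dphi | exact: Dpsi
  | exact: (CkSW hphi) | exact: (CkSW hpsi)].
Qed.

(** The derivative of [phi^-1] is a product of derivatives of [phi] and of
    copies of [phi^-1], so the induction on [k] needs no chain rule. *)
Lemma CkV k phi : (forall p, phi p != 0) -> Ck k phi ->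
  Ck k (fun p => (phi p)^-1).
Proof.
move=> phi0; elim: k => [|k IH].
  by move=> cphi p; apply: continuousV => //; exact: cphi.
move=> hphi; have [dphi Dphi] := hphi.
split=> [p|v]; first exact: differentiableV.
apply: (@eq_Ck _ (fun p => (-1 * 'D_v phi p) * ((phi p)^-1 * (phi p)^-1))).
  by move=> p; rewrite derive_inv // mulN1r.
apply: CkM; last by apply: CkM; apply: IH; exact: (CkSW hphi).
by apply: CkM; [exact: Ck_cst|exact: Dphi].
Qed.

Lemma derive_coord i p v : 'D_v (fun q : V => q 0 i : R) p = v 0 i.
Proof.
apply: cvg_lim => //.
apply: (cvg_trans (G := (cst (v 0 i)) @ 0^')); last exact: cvg_cst.
apply: near_eq_cvg; near=> h.
rewrite /= !mxE addrK /GRing.scale /= mulrA mulVf ?mul1r //.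
by near: h; exact: nbhs_dnbhs_neq.
Unshelve. all: by end_near. Qed.

Lemma smooth_differentiable phi p : smooth phi -> differentiable phi p.
Proof. by move=> /(_ 1%N)[]. Qed.

Lemma smooth_derive phi v : smooth phi -> smooth (fun p => 'D_v phi p).
Proof. by move=> sphi k; have [_] := sphi k.+1; exact. Qed.

Lemma smooth_cst (c : R) : smooth (fun _ : V => c).
Proof. by move=> k; exact: Ck_cst. Qed.

Lemma smoothD phi psi :
  smooth phi -> smooth psi -> smooth (fun p => phi p + psi p).
Proof. by move=> sphi spsi k; exact: CkD. Qed.

Lemma smoothM phi psi :
  smooth phi -> smooth psi -> smooth (fun p => phi p * psi p).
Proof. by move=> sphi spsi k; exact: CkM. Qed.

Lemma smoothV phi : (forall p, phi p != 0) ->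
  smooth phi -> smooth (fun p => (phi p)^-1).
Proof. by move=> phi0 sphi k; exact: CkV. Qed.

Lemma smoothN phi : smooth phi -> smooth (fun p => - phi p).
Proof.
move=> sphi k; apply: (@eq_Ck _ (fun p => -1 * phi p)) => [p|].
  by rewrite mulN1r.
by apply: CkM => //; exact: Ck_cst.
Qed.

Lemma smoothB phi psi :
  smooth phi -> smooth psi -> smooth (fun p => phi p - psi p).
Proof. by move=> sphi spsi; apply: smoothD => //; exact: smoothN. Qed.

Lemma smooth_sum m (F : 'I_m -> V -> R) :
  (forall i, smooth (F i)) -> smooth (fun p => \sum_i F i p).
Proof.
elim: m F => [|m IH] F sF.
  under eq_fun do rewrite big_ord0.
  exact: smooth_cst.
under eq_fun do rewrite big_ord_recl.
by apply: smoothD => //; exact: IH.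
Qed.

Lemma smooth_coord i : smooth (fun p : V => p 0 i).
Proof.
case=> [|k]; first exact: coord_continuous.
split=> [p|v]; first exact: differentiable_coord.
by apply: (eq_Ck _ (Ck_cst k (v 0 i))) => p; rewrite derive_coord.
Qed.

Lemma smooth1_derive1 (f : R -> R) : smooth1 f -> smooth1 (derive1 f).
Proof. by move=> sf k t; rewrite -derive1Sn; exact: sf. Qed.

Lemma derive_comp_coord (f : R -> R) i p v : derivable f (p 0 i) 1 ->
  'D_v (fun q : V => f (q 0 i)) p = (derive1 f) (p 0 i) * v 0 i.
Proof.
move=> /derivable1_diffP df.
have dc : differentiable (fun q : V => q 0 i : R) p.
  exact: differentiable_coord.
rewrite deriveE; last exact: (differentiable_comp dc).
rewrite (_ : (fun q => _) = f \o (fun q : V => q 0 i : R)) // diff_comp //=.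
rewrite -(deriveE _ dc) derive_coord deriv1E; last exact/derivable1_diffP.
by rewrite /GRing.scale /= mulrC.
Qed.

Lemma smooth_comp_coord (f : R -> R) i :
  smooth1 f -> smooth (fun p : V => f (p 0 i)).
Proof.
move=> sf k; elim: k f sf => [|k IH] f sf.
  move=> p; apply: (@continuous_comp _ _ _ (fun q : V => q 0 i) f).
    exact: coord_continuous.
  by apply: differentiable_continuous; apply/derivable1_diffP; exact: (sf 0%N).
split=> [p|v].
  apply: (@differentiable_comp _ _ _ _ (fun q : V => q 0 i) f).
    exact: differentiable_coord.
  by apply/derivable1_diffP; exact: (sf 0%N).
apply: (@eq_Ck _ (fun p => (derive1 f) (p 0 i) * v 0 i)).
  by move=> p; rewrite derive_comp_coord//; exact: (sf 0%N).
by apply: CkM; [apply: IH; exact: smooth1_derive1|exact: Ck_cst].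
Qed.

Lemma mean_value_on_line phi p v (d : R) :
  0 < d -> (forall q, differentiable phi q) ->
  exists2 c, 0 <= c <= d & phi (d *: v + p) - phi p = 'D_v phi (c *: v + p) * d.
Proof.
move=> d0 dphi; pose g (h : R) := phi (h *: v + p).
have dg h : is_derive h (1 : R) g ('D_v phi (h *: v + p)).
  have dl : derivable phi (h *: v + p) v by exact: diff_derivable.
  have shiftE (k : R) : g (k *: (1 : R) + h) = phi (k *: v + (h *: v + p)).
    by rewrite /g [k *: (1 : R)](mulr1 k) scalerDl addrA.
  apply: DeriveDef.
    apply/(derivable1P g h 1).
    rewrite (_ : (fun k : R => _) = fun k : R => phi (k *: v + (h *: v + p))).
      exact/(derivable1P phi (h *: v + p) v).
    by apply/funext.
  rewrite /derive (_ : (fun k : R =>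
      k^-1 *: ((g \o shift h) (k *: (1 : R)) - g h)) = fun k : R =>
    k^-1 *: ((phi \o shift (h *: v + p)) (k *: v) - phi (h *: v + p))) //.
  by apply/funext => k; rewrite /= shiftE.
have [|c hc] := @MVT_segment R g (fun h => 'D_v phi (h *: v + p)) 0 d (ltW d0)
  (fun x _ => dg x).
  by apply: derivable_within_continuous => x _; have [] := dg x.
rewrite /g scale0r add0r subr0 => e; exists c => //.
Qed.

(** The mean value theorem along [u], applied to the increment
    [q |-> phi (q + d v) - phi q], followed by the mean value theorem along
    [v], applied to ['D_u phi]. The left-hand side is symmetric in [u] and [v]. *)
Lemma second_difference phi p u v (d : R) : smooth phi -> 0 < d ->
  exists a b, [/\ 0 <= a <= d, 0 <= b <= d &
    phi (d *: u + (d *: v + p)) - phi (d *: u + p)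
      - phi (d *: v + p) + phi p =
    'D_v (fun q => 'D_u phi q) (a *: u + (b *: v + p)) * d * d].
Proof.
move=> sphi d0.
pose psi q := phi (d *: v + q) - phi q.
have dsh q : differentiable (fun q => d *: v + q) q.
  by apply: differentiableD; [exact: differentiable_cst|].
have dpsi q : differentiable psi q.
  apply: differentiableB; last exact: smooth_differentiable.
  by apply: differentiable_comp => //; exact: smooth_differentiable.
have [a ha ea] := mean_value_on_line p u d0 dpsi.
have [b hb eb] := mean_value_on_line (a *: u + p) v d0
  (fun q => smooth_differentiable q (smooth_derive u sphi)).
exists a, b; split=> //.
have -> : phi (d *: u + (d *: v + p)) - phi (d *: u + p)
      - phi (d *: v + p) + phi p = psi (d *: u + p) - psi p.
  rewrite /psi (addrCA (d *: u)) opprB addrA -!addrA.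
  by congr (_ + (_ + _)); rewrite addrC.
rewrite ea (_ : a *: u + (b *: v + p) = b *: v + (a *: u + p)); last first.
  by rewrite addrCA.
rewrite -eb; congr (_ * _).
have -> : psi = (fun q => phi (d *: v + q)) - phi by [].
rewrite deriveB; last 2 first.
- apply: diff_derivable; apply: differentiable_comp => //.
  exact: smooth_differentiable.
- by apply: diff_derivable; exact: smooth_differentiable.
congr (_ - _).
by rewrite /derive (_ : (fun k : R => k^-1 *: (((fun q => phi (d *: v + q)) \o
    shift (a *: u + p)) (k *: u) - phi (d *: v + (a *: u + p)))) = fun k : R =>
   k^-1 *: ((phi \o shift (d *: v + (a *: u + p))) (k *: u)
   - phi (d *: v + (a *: u + p)))) //; apply/funext => k /=; rewrite addrCA.
Qed.

(** Symmetry of second derivatives. By [second_difference], used for [u, v] and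
    for [v, u], the two mixed derivatives take a common value at two points
    that can be chosen arbitrarily close to [p]; both are continuous. *)
Lemma derive_comm phi p u v : smooth phi ->
  'D_v (fun q => 'D_u phi q) p = 'D_u (fun q => 'D_v phi q) p.
Proof.
move=> sphi.
set A := fun q => 'D_v (fun q => 'D_u phi q) q.
set B := fun q => 'D_u (fun q => 'D_v phi q) q.
have sA : smooth A by do 2 apply: smooth_derive.
have sB : smooth B by do 2 apply: smooth_derive.
rewrite -/(A p) -/(B p).
have cA := sA 0%N p; have cB := sB 0%N p.
apply/eqP; rewrite -subr_eq0 -normr_le0; apply/ler_addgt0Pl => e e0.
rewrite addr0.
have e2 : 0 < e / 2 by rewrite divr_gt0.
have /nbhs_ballP[rA /= rA0 hA] : \forall q \near p, `|A p - A q| < e / 2.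
  by move/cvgrPdist_lt : cA; exact.
have /nbhs_ballP[rB /= rB0 hB] : \forall q \near p, `|B p - B q| < e / 2.
  by move/cvgrPdist_lt : cB; exact.
pose r := Num.min rA rB.
have r0 : 0 < r by rewrite lt_min rA0.
(* With this [d], the whole parallelogram spanned by [d u] and [d v] at [p]
   lies in the ball of radius [r]. *)
pose d := r / (`|u| + `|v| + 1).
have k0 : 0 < `|u| + `|v| + 1 by rewrite ltr_wpDl// addr_ge0.
have d0 : 0 < d by rewrite divr_gt0.
have near_p a b : 0 <= a <= d -> 0 <= b <= d ->
    `|p - (a *: u + (b *: v + p))| < r.
  move=> /andP[a0 ad] /andP[b0 bd].
  rewrite addrA opprD addrCA subrr addr0 normrN.
  apply: (le_lt_trans (ler_normD _ _)); rewrite !normrZ !ger0_norm //.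
  have hr : r = d * (`|u| + `|v| + 1) by rewrite /d mulfVK// gt_eqF.
  rewrite hr mulrDr mulr1 ltr_pwDr // mulrDr lerD //; exact: ler_wpM2r.
have [a [b [ha hb eab]]] := second_difference p u v sphi d0.
have [a' [b' [ha' hb' eab']]] := second_difference p v u sphi d0.
have AB : A (a *: u + (b *: v + p)) = B (a' *: v + (b' *: u + p)).
  have dd : d != 0 by rewrite gt_eqF.
  apply: (mulIf dd); apply: (mulIf dd).
  apply: etrans (esym eab) (etrans _ eab').
  rewrite (addrCA (d *: u)); congr (_ + _).
  by rewrite -!addrA; congr (_ + _); rewrite addrC.
have hpA : `|A p - A (a *: u + (b *: v + p))| < e / 2.
  apply: hA; rewrite -ball_normE /=.
  by apply: lt_le_trans (near_p _ _ ha hb) _; rewrite /r ge_min lexx.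
have hpB : `|B p - B (a' *: v + (b' *: u + p))| < e / 2.
  apply: hB; rewrite -ball_normE /= (addrCA (a' *: v)).
  by apply: lt_le_trans (near_p _ _ hb' ha') _; rewrite /r ge_min lexx orbT.
rewrite (_ : A p - B p = (A p - A (a *: u + (b *: v + p)))
   - (B p - B (a' *: v + (b' *: u + p)))); last first.
  by rewrite AB opprB addrA subrK.
rewrite (splitr e); apply: le_trans (ler_normB _ _) _.
by apply: lerD; apply: ltW; [exact: hpA|exact: hpB].
Qed.

Lemma dir_add X phi psi p : smooth phi -> smooth psi ->
  dir X (fun q => phi q + psi q) p = dir X phi p + dir X psi p.
Proof. by move=> *; apply: derive_add; exact: smooth_differentiable. Qed.

Lemma dir_mul X phi psi p : smooth phi -> smooth psi ->
  dir X (fun q => phi q * psi q) p = dir X phi p * psi p + phi p * dir X psi p.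
Proof. by move=> *; apply: derive_mul; exact: smooth_differentiable. Qed.

Lemma dir_inv X phi p : smooth phi -> phi p != 0 ->
  dir X (fun q => (phi q)^-1) p = - dir X phi p * ((phi p)^-1 * (phi p)^-1).
Proof. by move=> *; apply: derive_inv => //; exact: smooth_differentiable. Qed.

Lemma dir_cst X c p : dir X (fun=> c) p = 0 :> R.
Proof. exact: derive_cst. Qed.

Lemma dir_opp X phi p : smooth phi ->
  dir X (fun q => - phi q) p = - dir X phi p.
Proof.
by move=> *; apply: deriveN; apply/diff_derivable/smooth_differentiable.
Qed.

Lemma dir_sub X phi psi p : smooth phi -> smooth psi ->
  dir X (fun q => phi q - psi q) p = dir X phi p - dir X psi p.
Proof. by move=> *; rewrite dir_add ?dir_opp//; exact: smoothN. Qed.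

Lemma dir_sum X m (F : 'I_m -> V -> R) p : (forall i, smooth (F i)) ->
  dir X (fun q => \sum_i F i q) p = \sum_i dir X (F i) p.
Proof.
elim: m F => [|m IH] F sF.
  by under eq_fun do rewrite big_ord0; rewrite dir_cst big_ord0.
under eq_fun do rewrite big_ord_recl.
by rewrite dir_add// ?IH ?big_ord_recl//; exact: smooth_sum.
Qed.

Lemma dir_coordE X phi p : smooth phi ->
  dir X phi p = \sum_i X p 0 i * 'D_(delta_mx 0 i) phi p.
Proof.
move=> sphi; have dphi : differentiable phi p by exact: smooth_differentiable.
rewrite /dir deriveE// {1}[X p]row_sum_delta linear_sum; apply: eq_bigr => i _.
by rewrite linearZ /= deriveE.
Qed.

Lemma dir_vecD X Y phi p : smooth phi ->
  dir (fun q => X q + Y q) phi p = dir X phi p + dir Y phi p.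
Proof.
move=> sphi; have dphi : differentiable phi p by exact: smooth_differentiable.
by rewrite /dir !deriveE// linearD.
Qed.

Lemma dir_vecZ (psi : V -> R) X phi p : smooth phi ->
  dir (fun q => psi q *: X q) phi p = psi p * dir X phi p.
Proof.
move=> sphi; have dphi : differentiable phi p by exact: smooth_differentiable.
by rewrite /dir !deriveE// linearZ.
Qed.

Lemma dir_vecB X Y phi p : smooth phi ->
  dir (fun q => X q - Y q) phi p = dir X phi p - dir Y phi p.
Proof.
move=> sphi; have dphi : differentiable phi p by exact: smooth_differentiable.
by rewrite /dir !deriveE// linearB.
Qed.

Lemma smooth_dir X phi : vector_field X -> smooth phi -> smooth (dir X phi).
Proof.
move=> sX sphi; rewrite (_ : dir X phi =
    fun p => \sum_i X p 0 i * 'D_(delta_mx 0 i) phi p).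
  by apply: smooth_sum => i; apply: smoothM => //; exact: smooth_derive.
by apply/funext => p; exact: dir_coordE.
Qed.

Lemma vector_field_bracket X Y :
  vector_field X -> vector_field Y -> vector_field (bracket X Y).
Proof.
move=> sX sY i; rewrite (_ : (fun p => _) = fun p =>
  dir X (fun q => Y q 0 i) p - dir Y (fun q => X q 0 i) p).
  by apply: smoothB; exact: smooth_dir.
by apply/funext => p; rewrite /bracket mxE.
Qed.

(** The bracket as a commutator of derivations: the second-order terms of
    [dir X (dir Y phi)] and [dir Y (dir X phi)] cancel by [derive_comm]. This makes
    the second derivatives disappear from the curvature. *)
Lemma dir_bracket X Y phi p : vector_field X -> vector_field Y -> smooth phi ->
  dir (bracket X Y) phi p = dir X (dir Y phi) p - dir Y (dir X phi) p.
Proof.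
move=> sX sY sphi.
have dirE Z : dir Z phi = fun q => \sum_i Z q 0 i * 'D_(delta_mx 0 i) phi q.
  by apply/funext => q; exact: dir_coordE.
have dir2 Z W : vector_field Z -> vector_field W -> dir Z (dir W phi) p =
    \sum_i dir Z (fun q => W q 0 i) p * 'D_(delta_mx 0 i) phi p +
    \sum_i \sum_j W p 0 i * Z p 0 j *
      'D_(delta_mx 0 j) (fun q => 'D_(delta_mx 0 i) phi q) p.
  move=> sZ sW; have sD i := smooth_derive (delta_mx 0 i) sphi.
  rewrite (dirE W) dir_sum; last by move=> i; apply: smoothM.
  rewrite -big_split; apply: eq_bigr => i _ /=.
  rewrite dir_mul//; congr (_ + _).
  rewrite dir_coordE// mulr_sumr; apply: eq_bigr => j _.
  by rewrite mulrA.
rewrite !dir2// (exchange_big_dep xpredT) //= opprD addrACA.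
rewrite [X in _ + X](_ : _ = 0) ?addr0; last first.
  apply/eqP; rewrite subr_eq0; apply/eqP; apply: eq_bigr => j _.
  apply: eq_bigr => i _; rewrite (mulrC (Y p 0 i)).
  by rewrite (derive_comm p (delta_mx 0 i) (delta_mx 0 j) sphi).
rewrite dirE -sumrB; apply: eq_bigr => i _.
by rewrite /bracket mxE mulrBl.
Qed.

Lemma dir_comp_coord X (f : R -> R) i p : smooth1 f ->
  dir X (fun q => f (q 0 i)) p = (derive1 f) (p 0 i) * X p 0 i.
Proof. by move=> sf; apply: derive_comp_coord; exact: (sf 0%N). Qed.

Lemma dir_coord X i p : dir X (fun q => q 0 i) p = X p 0 i.
Proof. exact: derive_coord. Qed.

End SmoothFunctions.

(** * Orthogonal projections and the Heisenberg frame *)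

Section OrthogonalProjection.
Context {R : realType} {n : nat}.
Local Notation V := 'rV[R]_n.+1.

(** The projection is obtained by choice; positivity of [b] on [U] forces the
    chosen vector: the difference of two candidates lies in [U] and is
    orthogonal to [U], hence to itself. *)
Lemma oproj_eq (b : V -> V -> R) (U : 'M[R]_n.+1) (u w : V) :
  (forall x y z, b (x - y) z = b x z - b y z) ->
  (forall v, (v <= U)%MS -> b v v = 0 -> v = 0) ->
  (w <= U)%MS -> (forall v, (v <= U)%MS -> b (u - w) v = 0) ->
  oproj b U u = w.
Proof.
move=> bB bdef wU worth; rewrite /oproj.
set P := [set w : V | _]; have Pw : P w by [].
have [w'U w'orth] : P (get P) by exact: (getI Pw).
set w' := get P in w'U w'orth *.
have dU : (w' - w <= U)%MS by rewrite addmx_sub// eqmx_opp.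
apply/eqP; rewrite -subr_eq0; apply/eqP; apply: bdef => //.
have {1}-> : w' - w = (u - w) - (u - w').
  by rewrite opprB [RHS]addrC addrA subrK.
by rewrite bB worth// w'orth// subrr.
Qed.

End OrthogonalProjection.

Section HeisenbergFrame.
Context {R : realType}.
Local Notation H3 := 'rV[R]_3.
Implicit Types (q u v : H3).

Lemma vec3E (a b c : R) : (vec3 a b c 0 0 = a) * (vec3 a b c 0 1 = b) *
  (vec3 a b c 0 2 = c).
Proof. by rewrite !mxE. Qed.

Lemma row3P u v : u 0 0 = v 0 0 -> u 0 1 = v 0 1 -> u 0 2 = v 0 2 -> u = v.
Proof.
move=> h0 h1 h2; apply/rowP => -[[|[|[|//]]] hi].
- by rewrite (_ : Ordinal hi = 0) //; exact: val_inj.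
- by rewrite (_ : Ordinal hi = 1) //; exact: val_inj.
- by rewrite (_ : Ordinal hi = 2) //; exact: val_inj.
Qed.

Lemma thetaD q u v : theta q (u + v) = theta q u + theta q v.
Proof. by rewrite /theta !mxE; ring. Qed.

Lemma thetaZ q (k : R) u : theta q (k *: u) = k * theta q u.
Proof. by rewrite /theta !mxE; ring. Qed.

Lemma thetaN q u : theta q (- u) = - theta q u.
Proof. by rewrite /theta !mxE; ring. Qed.

Lemma theta_frame q : (theta q (e1 q) = 0) * (theta q (e2 q) = 0) *
  (theta q (e3 q) = 1).
Proof. by rewrite /theta /e1 /e2 /e3 !vec3E; do ![split]; field. Qed.

(** [dx], [dy] and [theta] form the coframe dual to [e1], [e2], [e3]. *)
Lemma H3_decomp q u :
  u = u 0 0 *: e1 q + u 0 1 *: e2 q + theta q u *: e3 q.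
Proof.
by apply: row3P; rewrite /theta !mxE /=; field.
Qed.

Lemma D1P q v : reflect (theta q v = 0) (v <= D1 q)%MS.
Proof.
apply: (iffP idP) => [/sub_addsmxP[[a b] /= ->]|v0].
  by rewrite [a]mx11_scalar [b]mx11_scalar !mul_scalar_mx thetaD !thetaZ
    !theta_frame !mulr0 addr0.
rewrite (H3_decomp q v) v0 scale0r addr0.
by apply: addmx_sub_adds; exact: scalemx_sub.
Qed.

Lemma D1perpP q v : (v <= D1perp q)%MS -> v = theta q v *: e3 q.
Proof.
rewrite /D1perp genmxE => /sub_rVP[k ->].
by rewrite thetaZ theta_frame mulr1.
Qed.

Lemma gH3Bl q u v w : gH3 q (u - v) w = gH3 q u w - gH3 q v w.
Proof. by rewrite /gH3 thetaD thetaN !mxE; ring. Qed.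

Lemma sqr_add_eq0 (a b c : R) : a * a + b * b + c * c = 0 ->
  [/\ a = 0, b = 0 & c = 0].
Proof.
rewrite -!expr2 => /eqP; rewrite !paddr_eq0 ?addr_ge0 ?sqr_ge0// !sqrf_eq0.
by case/andP => /andP[/eqP-> /eqP->] /eqP->.
Qed.

Lemma gH3_def q u : gH3 q u u = 0 -> u = 0.
Proof.
move=> /sqr_add_eq0[h0 h1 h2]; rewrite (H3_decomp q u) h0 h1 h2.
by rewrite !scale0r !addr0.
Qed.

Lemma oproj_D1 q u : oproj (gH3 q) (D1 q) u = u 0 0 *: e1 q + u 0 1 *: e2 q.
Proof.
apply: oproj_eq; first exact: gH3Bl.
- by move=> v _; exact: gH3_def.
- by apply/D1P; rewrite thetaD !thetaZ !theta_frame; ring.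
- move=> v /D1P v0; rewrite {1}(H3_decomp q u) addrAC subrr add0r.
  by rewrite /gH3 v0 /e3 !mxE /=; ring.
Qed.

Lemma oproj_D1perp q u : oproj (gH3 q) (D1perp q) u = theta q u *: e3 q.
Proof.
apply: oproj_eq; first exact: gH3Bl.
- by move=> v _; exact: gH3_def.
- by rewrite genmxE scalemx_sub.
- move=> v /D1perpP ->; rewrite {1}(H3_decomp q u) addrK.
  by rewrite /gH3 thetaD !thetaZ !theta_frame !mxE /=; ring.
Qed.

Lemma gD1E q u v : gD1 q u v = u 0 0 * v 0 0 + u 0 1 * v 0 1.
Proof.
rewrite /gD1 !oproj_D1 /gH3 !thetaD !thetaZ !theta_frame.
by rewrite !mxE /=; ring.
Qed.

Lemma gD1perpE q u v : gD1perp q u v = theta q u * theta q v.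
Proof.
rewrite /gD1perp !oproj_D1perp /gH3 !thetaZ !theta_frame.
by rewrite !mxE /=; ring.
Qed.

End HeisenbergFrame.

(** * The frame of the product *)

Section Frame.
Context {R : realType}.
Local Notation M := 'rV[R]_(1 + 3).
Implicit Types (p u v : M) (X Y Z : M -> M) (k : R).

(** The components of a vector field in the frame [partial_t], [e1], [e2],
    [e3]. All tensors below have constant or [t]-dependent coefficients in this
    frame, contrary to the coordinate frame. *)
Definition coef0 (X : M -> M) p : R := pi1 (X p).
Definition coef1 (X : M -> M) p : R := pi2 (X p) 0 0.
Definition coef2 (X : M -> M) p : R := pi2 (X p) 0 1.
Definition coef3 (X : M -> M) p : R := theta (pi2 p) (pi2 (X p)).

Definition frame p (a b c d : R) : M :=
  a *: partial_t p + b *: e1M p + c *: e2M p + d *: row_mx 0 (e3 (pi2 p)).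

Lemma pi1D u v : pi1 (u + v) = pi1 u + pi1 v.
Proof. by rewrite /pi1 !mxE. Qed.
Lemma pi1Z k u : pi1 (k *: u) = k * pi1 u.
Proof. by rewrite /pi1 !mxE. Qed.
Lemma pi1N u : pi1 (- u) = - pi1 u.
Proof. by rewrite /pi1 !mxE. Qed.
Lemma pi1_row (a : 'rV[R]_1) (w : 'rV[R]_3) : pi1 (row_mx a w) = a 0 0.
Proof. by rewrite /pi1 row_mxKl. Qed.
Lemma pi2D u v : pi2 (u + v) = pi2 u + pi2 v.
Proof. by apply/rowP => i; rewrite !mxE. Qed.
Lemma pi2Z k u : pi2 (k *: u) = k *: pi2 u.
Proof. by apply/rowP => i; rewrite !mxE. Qed.
Lemma pi2N u : pi2 (- u) = - pi2 u.
Proof. by apply/rowP => i; rewrite !mxE. Qed.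
Lemma pi2_row (a : 'rV[R]_1) (w : 'rV[R]_3) : pi2 (row_mx a w) = w.
Proof. exact: row_mxKr. Qed.

Lemma pi1E u : pi1 u = u 0 (lshift 3 0).
Proof. by rewrite /pi1 mxE. Qed.
Lemma pi2E u i : pi2 u 0 i = u 0 (rshift 1 i).
Proof. by rewrite /pi2 mxE. Qed.

Lemma pi1_frame p a b c d : pi1 (frame p a b c d) = a.
Proof. by rewrite /frame !pi1D !pi1Z !pi1_row !mxE /=; ring. Qed.

Lemma pi2_frame p a b c d : pi2 (frame p a b c d) =
  b *: e1 (pi2 p) + c *: e2 (pi2 p) + d *: e3 (pi2 p).
Proof. by rewrite /frame !pi2D !pi2Z !pi2_row scaler0 add0r. Qed.

Lemma coef_frame (a b c d : M -> R) p :
  let X := fun q => frame q (a q) (b q) (c q) (d q) in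
  (coef0 X p = a p) * (coef1 X p = b p) * (coef2 X p = c p) *
  (coef3 X p = d p).
Proof.
rewrite /coef0 /coef1 /coef2 /coef3 /= pi1_frame pi2_frame !thetaD !thetaZ.
rewrite !theta_frame !mxE /=.
by do ![split]; ring.
Qed.

Lemma vec_ext p u v : pi1 u = pi1 v -> pi2 u 0 0 = pi2 v 0 0 ->
  pi2 u 0 1 = pi2 v 0 1 -> theta (pi2 p) (pi2 u) = theta (pi2 p) (pi2 v) ->
  u = v.
Proof.
move=> h0 h1 h2 h3.
have e2 : pi2 u = pi2 v.
  by rewrite (H3_decomp (pi2 p) (pi2 u)) h1 h2 h3 -H3_decomp.
rewrite -[u](hsubmxK u) -[v](hsubmxK v); congr row_mx => //.
by apply/rowP => i; rewrite ord1.
Qed.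

Lemma field_ext X Y p : coef0 X p = coef0 Y p -> coef1 X p = coef1 Y p ->
  coef2 X p = coef2 Y p -> coef3 X p = coef3 Y p -> X p = Y p.
Proof. exact: vec_ext. Qed.

Lemma frame_coef X p :
  X p = frame p (coef0 X p) (coef1 X p) (coef2 X p) (coef3 X p).
Proof.
pose Y q := frame q (coef0 X q) (coef1 X q) (coef2 X q) (coef3 X q).
by apply: (@field_ext X Y); rewrite coef_frame.
Qed.

Lemma coefD X Y p :
  (coef0 (fun q => X q + Y q) p = coef0 X p + coef0 Y p) *
  (coef1 (fun q => X q + Y q) p = coef1 X p + coef1 Y p) *
  (coef2 (fun q => X q + Y q) p = coef2 X p + coef2 Y p) *
  (coef3 (fun q => X q + Y q) p = coef3 X p + coef3 Y p).
Proof.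
by rewrite /coef0 /coef1 /coef2 /coef3 pi1D pi2D thetaD !mxE.
Qed.

Lemma coefB X Y p :
  (coef0 (fun q => X q - Y q) p = coef0 X p - coef0 Y p) *
  (coef1 (fun q => X q - Y q) p = coef1 X p - coef1 Y p) *
  (coef2 (fun q => X q - Y q) p = coef2 X p - coef2 Y p) *
  (coef3 (fun q => X q - Y q) p = coef3 X p - coef3 Y p).
Proof.
by rewrite /coef0 /coef1 /coef2 /coef3 pi1D pi1N pi2D pi2N thetaD thetaN !mxE.
Qed.

Lemma coefZ (phi : M -> R) X p :
  (coef0 (fun q => phi q *: X q) p = phi p * coef0 X p) *
  (coef1 (fun q => phi q *: X q) p = phi p * coef1 X p) *
  (coef2 (fun q => phi q *: X q) p = phi p * coef2 X p) *
  (coef3 (fun q => phi q *: X q) p = phi p * coef3 X p).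
Proof.
by rewrite /coef0 /coef1 /coef2 /coef3 pi1Z pi2Z thetaZ !mxE.
Qed.

Lemma smooth_pi2 i : smooth (fun p : M => pi2 p 0 i).
Proof.
by under eq_fun do rewrite pi2E; exact: (@smooth_coord R 3).
Qed.

Lemma coef0E X : coef0 X = fun p => X p 0 (lshift 3 0).
Proof. by apply/funext => p; rewrite /coef0 pi1E. Qed.

Lemma coef1E X : coef1 X = fun p => X p 0 (rshift 1 0).
Proof. by apply/funext => p; rewrite /coef1 pi2E. Qed.

Lemma coef2E X : coef2 X = fun p => X p 0 (rshift 1 1).
Proof. by apply/funext => p; rewrite /coef2 pi2E. Qed.

Lemma smooth_coef0 X : vector_field X -> smooth (coef0 X).
Proof. by move=> sX; rewrite coef0E; exact: sX. Qed.

Lemma smooth_coef1 X : vector_field X -> smooth (coef1 X).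
Proof. by move=> sX; rewrite coef1E; exact: sX. Qed.

Lemma smooth_coef2 X : vector_field X -> smooth (coef2 X).
Proof. by move=> sX; rewrite coef2E; exact: sX. Qed.

Lemma coef3E X : coef3 X = fun p => X p 0 (rshift 1 2) +
  2^-1 * (pi2 p 0 1 * coef1 X p - pi2 p 0 0 * coef2 X p).
Proof. by apply/funext => p; rewrite /coef3 /theta -pi2E. Qed.

Lemma smooth_coef3 X : vector_field X -> smooth (coef3 X).
Proof.
move=> sX; rewrite coef3E; apply: smoothD; first exact: sX.
apply: smoothM; first exact: smooth_cst.
apply: smoothB; apply: smoothM; first [exact: smooth_pi2
  |exact: smooth_coef1|exact: smooth_coef2].
Qed.

Lemma vector_field_frame (a b c d : M -> R) :
  smooth a -> smooth b -> smooth c -> smooth d ->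
  vector_field (fun p => frame p (a p) (b p) (c p) (d p)).
Proof.
move=> sa sb sc sd i.
case: (@split_ordP 1 3 i) => j ->; last first.
  have E p : frame p (a p) (b p) (c p) (d p) 0 (rshift 1 j) =
     b p * e1 (pi2 p) 0 j + c p * e2 (pi2 p) 0 j + d p * e3 (pi2 p) 0 j.
    by rewrite -pi2E pi2_frame 2!mxE; congr (_ + _ + _); rewrite mxE.
  under eq_fun do rewrite E.
  have se1 : smooth (fun p : M => e1 (pi2 p) 0 j).
    case: j {E} => [] [|[|[|//]]] hj;
    under eq_fun do rewrite mxE /=; try exact: smooth_cst.
    apply: smoothN; apply: smoothM; [exact: smooth_pi2|exact: smooth_cst].
  have se2 : smooth (fun p : M => e2 (pi2 p) 0 j).
    case: j {E se1} => [] [|[|[|//]]] hj;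
    under eq_fun do rewrite mxE /=; try exact: smooth_cst.
    apply: smoothM; [exact: smooth_pi2|exact: smooth_cst].
  have se3 : smooth (fun p : M => e3 (pi2 p) 0 j) by exact: smooth_cst.
  by apply: smoothD; [apply: smoothD|]; apply: smoothM.
rewrite ord1; under eq_fun do rewrite -pi1E pi1_frame.
exact: sa.
Qed.

Lemma DP p v : reflect (theta (pi2 p) (pi2 v) = 0) (v <= D p)%MS.
Proof.
apply: (iffP idP) => [|v0].
  move=> /sub_addsmxP[[a b] /= ->]; rewrite pi2D thetaD.
  have /sub_addsmxP[[a' b'] /= ->] :
      (a *m (partial_t p + e1M p)%MS <= partial_t p + e1M p)%MS.
    exact: submxMl.
  rewrite [b]mx11_scalar [a']mx11_scalar [b']mx11_scalar !mul_scalar_mx.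
  rewrite pi2D !pi2Z !pi2_row thetaD !thetaZ !theta_frame.
  rewrite (_ : theta (pi2 p) 0 = 0); first by ring.
  by rewrite /theta !mxE; ring.
rewrite (frame_coef (fun=> v) p) /frame [coef3 _ _]v0 scale0r addr0.
by apply: addmx_sub_adds; [apply: addmx_sub_adds|]; exact: scalemx_sub.
Qed.

(** The distribution is the kernel of the contact form [theta]. *)
Lemma sectionP X : section D X <-> vector_field X /\ coef3 X = fun=> 0.
Proof.
split=> -[sX h]; split=> //.
  by apply/funext => p; apply/DP.
by move=> p; apply/DP; have := congr1 (@^~ p) h.
Qed.

(** The only structure constants of the frame come from [e1, e2] = [e3]: they
    produce the zeroth-order term in the last component. *)
Lemma coef_bracket X Y p : vector_field X -> vector_field Y ->
  (coef0 (bracket X Y) p = dir X (coef0 Y) p - dir Y (coef0 X) p) *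
  (coef1 (bracket X Y) p = dir X (coef1 Y) p - dir Y (coef1 X) p) *
  (coef2 (bracket X Y) p = dir X (coef2 Y) p - dir Y (coef2 X) p) *
  (coef3 (bracket X Y) p = dir X (coef3 Y) p - dir Y (coef3 X) p
    + (coef1 X p * coef2 Y p - coef2 X p * coef1 Y p)).
Proof.
move=> sX sY.
have E0 : coef0 (bracket X Y) p = dir X (coef0 Y) p - dir Y (coef0 X) p.
  by rewrite !coef0E mxE.
have E1 : coef1 (bracket X Y) p = dir X (coef1 Y) p - dir Y (coef1 X) p.
  by rewrite !coef1E mxE.
have E2 : coef2 (bracket X Y) p = dir X (coef2 Y) p - dir Y (coef2 X) p.
  by rewrite !coef2E mxE.
do ![split=> //].
have dirc Z i : dir Z (fun q => pi2 q 0 i) p = pi2 (Z p) 0 i.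
  by under eq_fun do rewrite pi2E; rewrite dir_coord pi2E.
have dir3 Z W : vector_field Z -> vector_field W ->
    dir Z (coef3 W) p = dir Z (fun q => W q 0 (rshift 1 2)) p +
    2^-1 * (coef2 Z p * coef1 W p + pi2 p 0 1 * dir Z (coef1 W) p
     - (coef1 Z p * coef2 W p + pi2 p 0 0 * dir Z (coef2 W) p)).
  move=> sZ sW; have s1 := smooth_coef1 sW; have s2 := smooth_coef2 sW.
  have sM i phi : smooth phi -> smooth (fun q : M => pi2 q 0 i * phi q).
    by move=> sphi; apply: smoothM => //; exact: smooth_pi2.
  have sc : smooth (fun _ : M => 2^-1 : R) by exact: smooth_cst.
  rewrite coef3E dir_add; first last.
  - by apply: smoothM => //; apply: smoothB; exact: sM.
  - exact: sW.
  rewrite dir_mul//; last by apply: smoothB; exact: sM.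
  rewrite dir_cst mul0r add0r dir_sub; [|exact: sM..].
  by rewrite !dir_mul ?dirc //; exact: smooth_pi2.
rewrite !dir3// coef3E E1 E2 {1}/bracket mxE.
by field.
Qed.

End Frame.

(** * The warped metric and its Levi-Civita connection *)

Section WarpedMetric.
Context {R : realType}.
Local Notation M := 'rV[R]_(1 + 3).
Context (f : R -> R) (hf : smooth1 f) (f_neq0 : forall t, f t != 0).
Implicit Types (p u v : M) (X Y Z : M -> M) (k : R).

Definition warp p := f (pi1 p).
Definition warp' p := derive1 f (pi1 p).
Definition warp'' p := derive1 (derive1 f) (pi1 p).

Lemma warp_neq0 p : warp p != 0.
Proof. exact: f_neq0. Qed.

Lemma smooth_comp_pi1 (g : R -> R) :
  smooth1 g -> smooth (fun p : M => g (pi1 p)).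
Proof.
by move=> sg; under eq_fun do rewrite pi1E; exact: smooth_comp_coord.
Qed.

Lemma dir_comp_pi1 (g : R -> R) X p : smooth1 g ->
  dir X (fun p : M => g (pi1 p)) p = derive1 g (pi1 p) * coef0 X p.
Proof.
move=> sg; under eq_fun do rewrite pi1E.
by rewrite dir_comp_coord// /coef0 !pi1E.
Qed.

Lemma smooth_warp : smooth warp.
Proof. exact: smooth_comp_pi1. Qed.

Lemma smooth_warp' : smooth warp'.
Proof. exact: (smooth_comp_pi1 (smooth1_derive1 hf)). Qed.

Lemma dir_warp X p : dir X warp p = warp' p * coef0 X p.
Proof. exact: dir_comp_pi1. Qed.

Lemma dir_warp' X p : dir X warp' p = warp'' p * coef0 X p.
Proof. exact: (dir_comp_pi1 _ _ (smooth1_derive1 hf)). Qed.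

Lemma gDE X Y p : gD f p (X p) (Y p) = coef0 X p * coef0 Y p +
  warp p * warp p * (coef1 X p * coef1 Y p + coef2 X p * coef2 Y p).
Proof. by rewrite /gD gD1E expr2. Qed.

Lemma gME X Y p : gM f p (X p) (Y p) = coef0 X p * coef0 Y p +
  warp p * warp p * (coef1 X p * coef1 Y p + coef2 X p * coef2 Y p)
  + coef3 X p * coef3 Y p.
Proof. by rewrite /gM gDE gD1perpE. Qed.

Lemma gM_def p v : gM f p v v = 0 -> v = 0.
Proof.
rewrite (gME (fun=> v) (fun=> v)) => h.
have h0 : coef0 (fun=> v) p = 0 /\ [/\ warp p * coef1 (fun=> v) p = 0,
    warp p * coef2 (fun=> v) p = 0 & coef3 (fun=> v) p = 0].
  set x0 := coef0 _ p in h *; set x1 := coef1 _ p in h *.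
  set x2 := coef2 _ p in h *; set x3 := coef3 _ p in h *.
  set w := warp p in h *; clearbody x0 x1 x2 x3 w.
  have s0 := sqr_ge0 x0; have s1 := sqr_ge0 (w * x1).
  have s2 := sqr_ge0 (w * x2); have s3 := sqr_ge0 x3.
  by split; last split; apply/eqP; rewrite -sqrf_eq0; apply/eqP; nra.
case: h0 => h0 [/eqP h1 /eqP h2 h3].
move: h1 h2; rewrite !mulf_eq0 (negPf (warp_neq0 p)) /= => /eqP h1 /eqP h2.
rewrite (frame_coef (fun=> v) p) h0 h1 h2 h3 /frame !scale0r !addr0 //.
Qed.

Lemma gMBl p u v z : gM f p (u - v) z = gM f p u z - gM f p v z.
Proof.
rewrite (gME (fun=> u - v) (fun=> z)) (gME (fun=> u) (fun=> z)).
by rewrite (gME (fun=> v) (fun=> z)) !(coefB (fun=> u) (fun=> v)); ring.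
Qed.

Lemma gMC p u v : gM f p u v = gM f p v u.
Proof.
by rewrite (gME (fun=> u) (fun=> v)) (gME (fun=> v) (fun=> u)); ring.
Qed.

Lemma gMBr p u v z : gM f p u (v - z) = gM f p u v - gM f p u z.
Proof. by rewrite gMC gMBl !(gMC _ u). Qed.

Lemma coef_piD X p :
  (coef0 (piD f X) p = coef0 X p) * (coef1 (piD f X) p = coef1 X p) *
  (coef2 (piD f X) p = coef2 X p) * (coef3 (piD f X) p = 0).
Proof.
pose W q := frame q (coef0 X q) (coef1 X q) (coef2 X q) 0.
rewrite (_ : piD f X = W) ?coef_frame//.
apply/funext => q; rewrite /piD; apply: oproj_eq.
- by move=> *; exact: gMBl.
- by move=> v _; exact: gM_def.
- apply/DP.
  by have /= [_] := coef_frame (coef0 X) (coef1 X) (coef2 X) (fun=> 0) q.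
- move=> v /DP v0; rewrite (gME (fun q => X q - W q) (fun=> v)).
  rewrite !coefB !coef_frame /= [coef3 (fun=> v) q]v0.
  by ring.
Qed.

Lemma piDE X : piD f X = fun p => frame p (coef0 X p) (coef1 X p) (coef2 X p) 0.
Proof.
apply/funext => p; rewrite [LHS]frame_coef !coef_piD //.
Qed.

Lemma vector_field_piD X : vector_field X -> vector_field (piD f X).
Proof.
move=> sX; rewrite piDE; apply: (vector_field_frame (d := fun=> 0)).
- exact: smooth_coef0.
- exact: smooth_coef1.
- exact: smooth_coef2.
- exact: smooth_cst.
Qed.

Definition dlog_warp p := warp' p * (warp p)^-1.

(** The coefficients are those given by Koszul's formula in the orthogonal
    frame [partial_t], [e1], [e2], [e3], whose squared lengths are [1], [f^2],
    [f^2], [1]. The terms in [f'] are those of a warped product with fibre the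
    plane; the factors [1/2] come from [e1, e2] = [e3], and are divided by
    [f^2] where the result is a multiple of [e1] or [e2]. *)
Definition frame_connection X Y p : M := frame p
  (dir X (coef0 Y) p
     - warp p * warp' p * (coef1 X p * coef1 Y p + coef2 X p * coef2 Y p))
  (dir X (coef1 Y) p
     + dlog_warp p * (coef0 X p * coef1 Y p + coef1 X p * coef0 Y p)
     + 2^-1 * ((warp p)^-1 * (warp p)^-1) *
       (coef2 X p * coef3 Y p + coef3 X p * coef2 Y p))
  (dir X (coef2 Y) p
     + dlog_warp p * (coef0 X p * coef2 Y p + coef2 X p * coef0 Y p)
     - 2^-1 * ((warp p)^-1 * (warp p)^-1) *
       (coef1 X p * coef3 Y p + coef3 X p * coef1 Y p))
  (dir X (coef3 Y) p + 2^-1 * (coef1 X p * coef2 Y p - coef2 X p * coef1 Y p)).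

Lemma smooth_warpV : smooth (fun p => (warp p)^-1).
Proof. apply: smoothV; [exact: warp_neq0|exact: smooth_warp]. Qed.

Lemma smooth_dlog_warp : smooth dlog_warp.
Proof. apply: smoothM; [exact: smooth_warp'|exact: smooth_warpV]. Qed.

Lemma vector_field_frame_connection X Y :
  vector_field X -> vector_field Y -> vector_field (frame_connection X Y).
Proof.
move=> sX sY.
have [x0 x1 x2 x3] := And4 (smooth_coef0 sX) (smooth_coef1 sX)
  (smooth_coef2 sX) (smooth_coef3 sX).
have [y0 y1 y2 y3] := And4 (smooth_coef0 sY) (smooth_coef1 sY)
  (smooth_coef2 sY) (smooth_coef3 sY).
have sw := smooth_warp; have sw' := smooth_warp'.
have swV := smooth_warpV; have sh := smooth_dlog_warp.
have sc : smooth (fun _ : M => 2^-1 : R) by exact: smooth_cst.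
apply: vector_field_frame;
by repeat (first [assumption | exact: smooth_dir | apply: smoothD
  | apply: smoothN | apply: smoothM]).
Qed.

Lemma coef_frame_connection X Y p :
  let W := frame_connection X Y in
  (coef0 W p = dir X (coef0 Y) p
     - warp p * warp' p * (coef1 X p * coef1 Y p + coef2 X p * coef2 Y p)) *
  (coef1 W p = dir X (coef1 Y) p
     + dlog_warp p * (coef0 X p * coef1 Y p + coef1 X p * coef0 Y p)
     + 2^-1 * ((warp p)^-1 * (warp p)^-1) *
       (coef2 X p * coef3 Y p + coef3 X p * coef2 Y p)) *
  (coef2 W p = dir X (coef2 Y) p
     + dlog_warp p * (coef0 X p * coef2 Y p + coef2 X p * coef0 Y p)
     - 2^-1 * ((warp p)^-1 * (warp p)^-1) *
       (coef1 X p * coef3 Y p + coef3 X p * coef1 Y p)) *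
  (coef3 W p =
    dir X (coef3 Y) p + 2^-1 * (coef1 X p * coef2 Y p - coef2 X p * coef1 Y p)).
Proof.
exact: (@coef_frame _ _ _ _ _ p).
Qed.

Lemma vector_fieldD X Y : vector_field X -> vector_field Y ->
  vector_field (fun p => X p + Y p).
Proof. by move=> sX sY i; under eq_fun do rewrite mxE; exact: smoothD. Qed.

Lemma vector_fieldN X : vector_field X -> vector_field (fun p => - X p).
Proof. by move=> sX i; under eq_fun do rewrite mxE; exact: smoothN. Qed.

Lemma vector_fieldB X Y : vector_field X -> vector_field Y ->
  vector_field (fun p => X p - Y p).
Proof. by move=> sX sY; apply: vector_fieldD => //; exact: vector_fieldN. Qed.

(** The left-hand side of the compatibility with the metric, written in the
    frame: [y] and [z] are the components of the two fields, [w] is the warping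
    function. *)
Lemma dir_quadratic X (w y0 y1 y2 y3 z0 z1 z2 z3 : M -> R) p :
  smooth w -> smooth y0 -> smooth y1 -> smooth y2 -> smooth y3 ->
  smooth z0 -> smooth z1 -> smooth z2 -> smooth z3 ->
  dir X (fun q => y0 q * z0 q + w q * w q * (y1 q * z1 q + y2 q * z2 q)
    + y3 q * z3 q) p =
  dir X y0 p * z0 p + y0 p * dir X z0 p
  + 2 * w p * dir X w p * (y1 p * z1 p + y2 p * z2 p)
  + w p * w p * (dir X y1 p * z1 p + y1 p * dir X z1 p
    + dir X y2 p * z2 p + y2 p * dir X z2 p)
  + dir X y3 p * z3 p + y3 p * dir X z3 p.
Proof.
move=> sw sy0 sy1 sy2 sy3 sz0 sz1 sz2 sz3.
have s0 := smoothM sy0 sz0; have s1 := smoothM sy1 sz1.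
have s2 := smoothM sy2 sz2; have s3 := smoothM sy3 sz3.
have s12 := smoothD s1 s2; have sww := smoothM sw sw.
have s4 := smoothM sww s12; have s5 := smoothD s0 s4.
rewrite (dir_add X p s5 s3) (dir_add X p s0 s4) (dir_mul X p sww s12).
rewrite (dir_add X p s1 s2) !dir_mul //.
by ring.
Qed.

Ltac smooth_coef := first [exact: smooth_coef0 | exact: smooth_coef1
  | exact: smooth_coef2 | exact: smooth_coef3].

Lemma frame_connection_levi_civita : is_levi_civita (gM f) frame_connection.
Proof.
have coefDf X Y :
  (coef0 (fun q => X q + Y q) = fun p => coef0 X p + coef0 Y p) *
  (coef1 (fun q => X q + Y q) = fun p => coef1 X p + coef1 Y p) *
  (coef2 (fun q => X q + Y q) = fun p => coef2 X p + coef2 Y p) *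
  (coef3 (fun q => X q + Y q) = fun p => coef3 X p + coef3 Y p).
  by do ![split]; apply/funext => p; rewrite coefD.
have coefZf (phi : M -> R) X :
  (coef0 (fun q => phi q *: X q) = fun p => phi p * coef0 X p) *
  (coef1 (fun q => phi q *: X q) = fun p => phi p * coef1 X p) *
  (coef2 (fun q => phi q *: X q) = fun p => phi p * coef2 X p) *
  (coef3 (fun q => phi q *: X q) = fun p => phi p * coef3 X p).
  by do ![split]; apply/funext => p; rewrite coefZ.
split.
- exact: vector_field_frame_connection.
- move=> X X' Y sX sX' sY; apply/funext => p.
  apply: (@field_ext _ _ (fun q =>
    frame_connection X Y q + frame_connection X' Y q));
  rewrite [RHS]coefD !coef_frame_connection ?coefD !dir_vecD;
  first [ring | smooth_coef].
- move=> phi X Y sphi sX sY; apply/funext => p.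
  apply: (@field_ext _ _ (fun q => phi q *: frame_connection X Y q));
  rewrite [RHS]coefZ !coef_frame_connection ?coefZ !dir_vecZ;
  first [ring | smooth_coef].
- move=> X Y Y' sX sY sY'; apply/funext => p.
  apply: (@field_ext _ _ (fun q =>
    frame_connection X Y q + frame_connection X Y' q));
  rewrite [RHS]coefD !coef_frame_connection !coefDf dir_add /=;
  first [ring | smooth_coef].
- move=> phi X Y sphi sX sY; apply/funext => p.
  apply: (@field_ext _ _ (fun q =>
    dir X phi q *: Y q + phi q *: frame_connection X Y q));
  rewrite [RHS]coefD ![in RHS]coefZ !coef_frame_connection !coefZf dir_mul /=;
  first [ring | exact: sphi | smooth_coef].
- move=> X Y sX sY; apply/funext => p.
  apply: (@field_ext _ (fun q =>
    frame_connection X Y q - frame_connection Y X q));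
  rewrite [LHS]coefB !coef_frame_connection coef_bracket //; field;
  by rewrite ?warp_neq0.
- move=> X Y Z sX sY sZ; apply/funext => p.
  rewrite (_ : (fun q => gM f q (Y q) (Z q)) = fun q => coef0 Y q * coef0 Z q +
    warp q * warp q * (coef1 Y q * coef1 Z q + coef2 Y q * coef2 Z q)
    + coef3 Y q * coef3 Z q); last by apply/funext => q; exact: gME.
  have [y0 y1 y2 y3] := And4 (smooth_coef0 sY) (smooth_coef1 sY)
    (smooth_coef2 sY) (smooth_coef3 sY).
  have [z0 z1 z2 z3] := And4 (smooth_coef0 sZ) (smooth_coef1 sZ)
    (smooth_coef2 sZ) (smooth_coef3 sZ).
  have sw := smooth_warp.
  rewrite dir_quadratic // dir_warp.
  rewrite (gME (frame_connection X Y) Z) (gME Y (frame_connection X Z)).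
  rewrite !coef_frame_connection /dlog_warp.
  by field; rewrite ?warp_neq0.
Qed.

(** The difference of two such connections, lowered with the metric, is a
    trilinear form that is symmetric in its first two arguments (no torsion)
    and skew in its last two (compatibility with the metric). Such a form
    vanishes. *)
Lemma levi_civita_unique nabla nabla' X Y :
  is_levi_civita (gM f) nabla -> is_levi_civita (gM f) nabla' ->
  vector_field X -> vector_field Y -> nabla X Y = nabla' X Y.
Proof.
move=> L L' sX sY; apply/funext => p.
pose T U V W := gM f p (nabla U V p - nabla' U V p) (W p).
have sym U V W : vector_field U -> vector_field V -> T U V W = T V U W.
  move=> sU sV; rewrite /T; congr (gM f p _ _).
  have e := congr1 (@^~ p) (lc_torsion_free L sU sV).
  have e' := congr1 (@^~ p) (lc_torsion_free L' sU sV).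
  rewrite /= in e e'; rewrite -[nabla U V p](subrK (nabla V U p)) e.
  rewrite -[nabla' U V p](subrK (nabla' V U p)) e'.
  by rewrite opprD addrACA subrr add0r.
have skew U V W : vector_field U -> vector_field V -> vector_field W ->
    T U V W = - T U W V.
  move=> sU sV sW; rewrite /T [in RHS]gMC gMBl gMBr.
  have e := congr1 (@^~ p) (lc_metric L sU sV sW).
  have e' := congr1 (@^~ p) (lc_metric L' sU sV sW).
  by rewrite /= in e e'; move: e'; rewrite e => e'; lra.
have T0 U V W : vector_field U -> vector_field V -> vector_field W ->
    T U V W = 0.
  move=> sU sV sW.
  have h1 := sym U V W sU sV; have h2 := skew V U W sV sU sW.
  have h3 := sym V W U sV sW; have h4 := skew W V U sW sV sU.
  have h5 := sym W U V sW sU; have h6 := skew U W V sU sW sV.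
  by lra.
(* Nondegeneracy is applied to the difference itself, which is a smooth field
   because both connections preserve smoothness. *)
have sA : vector_field (fun q => nabla X Y q - nabla' X Y q).
  by apply: vector_fieldB; [exact: (lc_smooth L)|exact: (lc_smooth L')].
apply/eqP; rewrite -subr_eq0; apply/eqP; apply: (@gM_def p).
exact: (T0 X Y _ sX sY sA).
Qed.

Lemma levi_civitaE X Y : vector_field X -> vector_field Y ->
  levi_civita (gM f) X Y = frame_connection X Y.
Proof.
move=> sX sY; apply: levi_civita_unique => //.
- rewrite /levi_civita;
  apply: (@getI _ [set nabla | is_levi_civita (gM f) nabla]).
  exact: frame_connection_levi_civita.
- exact: frame_connection_levi_civita.
Qed.

End WarpedMetric.

(** * Curvature of the distribution *)

(** Turns an identity between components and derivatives at [p] into one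
    between independent scalars, which is then a matter of field arithmetic. *)
Ltac atomize p wn :=
  repeat match goal with |- context [dir ?X ?phi p] =>
    generalize (dir X phi p); intro end;
  repeat match goal with
  | |- context [coef0 ?X p] => generalize (coef0 X p); intro
  | |- context [coef1 ?X p] => generalize (coef1 X p); intro
  | |- context [coef2 ?X p] => generalize (coef2 X p); intro
  end;
  move: (warp'' _ p) (warp' _ p) (warp _ p) wn => w2 w1 w0 wn.

Section Curvature.
Context {R : realType}.
Local Notation M := 'rV[R]_(1 + 3).
Context (f : R -> R) (hf : smooth1 f) (f_neq0 : forall t, f t != 0).
Implicit Types (p u v : M) (X Y Z : M -> M) (k : R).
Local Notation w := (warp f).
Local Notation w' := (warp' f).
Local Notation w'' := (warp'' f).
Local Notation h := (dlog_warp f).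

Lemma section_piD X : vector_field X -> section D (piD f X).
Proof.
move=> sX; apply/sectionP; split; first exact: vector_field_piD.
by apply/funext => p; rewrite coef_piD.
Qed.

(** Sections have no component along [e3], and that of their covariant
    derivative is projected away, so all terms due to [e1, e2] = [e3]
    disappear: these are the formulas of the warped product of the line with
    the flat plane. *)
Lemma coef_nablaD X Y : section D X -> section D Y ->
  (coef0 (nablaD f X Y) = fun p => dir X (coef0 Y) p
     - w p * w' p * (coef1 X p * coef1 Y p + coef2 X p * coef2 Y p)) *
  (coef1 (nablaD f X Y) = fun p => dir X (coef1 Y) p
     + h p * (coef0 X p * coef1 Y p + coef1 X p * coef0 Y p)) *
  (coef2 (nablaD f X Y) = fun p => dir X (coef2 Y) p
     + h p * (coef0 X p * coef2 Y p + coef2 X p * coef0 Y p)).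
Proof.
move=> /sectionP[sX X3] /sectionP[sY Y3]; rewrite /nablaD levi_civitaE//.
by do ![split]; apply/funext => p; rewrite coef_piD // coef_frame_connection
  ?X3 ?Y3; ring.
Qed.

Lemma section_nablaD X Y : section D X -> section D Y ->
  section D (nablaD f X Y).
Proof.
move=> [sX _] [sY _]; rewrite /nablaD levi_civitaE//; apply: section_piD.
exact: vector_field_frame_connection.
Qed.

Lemma dir_dlog_warp X p : dir X h p =
  (w'' p * (w p)^-1 - w' p * w' p * ((w p)^-1 * (w p)^-1)) * coef0 X p.
Proof.
rewrite dir_mul; [|exact: smooth_warp'|exact: smooth_warpV].
rewrite (dir_inv X (smooth_warp hf) (warp_neq0 f_neq0 p)).
by rewrite dir_warp' // dir_warp //; ring.
Qed.

Lemma dir_sub_bilinear X (a c c' y1 y2 z1 z2 : M -> R) p :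
  smooth a -> smooth c -> smooth c' ->
  smooth y1 -> smooth y2 -> smooth z1 -> smooth z2 ->
  dir X (fun q => a q - c q * c' q * (y1 q * z1 q + y2 q * z2 q)) p =
  dir X a p
  - (dir X c p * c' p + c p * dir X c' p) * (y1 p * z1 p + y2 p * z2 p)
  - c p * c' p * (dir X y1 p * z1 p + y1 p * dir X z1 p
     + dir X y2 p * z2 p + y2 p * dir X z2 p).
Proof.
move=> sa sc sc' sy1 sy2 sz1 sz2.
have s1 := smoothM sy1 sz1; have s2 := smoothM sy2 sz2.
have s12 := smoothD s1 s2; have s3 := smoothM sc sc'.
rewrite (dir_sub X p sa (smoothM s3 s12)) (dir_mul X p s3 s12).
by rewrite (dir_mul X p sc sc') (dir_add X p s1 s2) !dir_mul//; ring.
Qed.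

Lemma dir_add_bilinear X (a c y1 y2 z1 z2 : M -> R) p :
  smooth a -> smooth c ->
  smooth y1 -> smooth y2 -> smooth z1 -> smooth z2 ->
  dir X (fun q => a q + c q * (y1 q * z1 q + y2 q * z2 q)) p =
  dir X a p + dir X c p * (y1 p * z1 p + y2 p * z2 p)
  + c p * (dir X y1 p * z1 p + y1 p * dir X z1 p
     + dir X y2 p * z2 p + y2 p * dir X z2 p).
Proof.
move=> sa sc sy1 sy2 sz1 sz2.
have s1 := smoothM sy1 sz1; have s2 := smoothM sy2 sz2.
have s12 := smoothD s1 s2.
rewrite (dir_add X p sa (smoothM sc s12)) (dir_mul X p sc s12).
by rewrite (dir_add X p s1 s2) !dir_mul//; ring.
Qed.

Lemma coef_subB (X1 X2 X3 X4 : M -> M) p :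
  let X := fun q => X1 q - X2 q - X3 q - X4 q in
  (coef0 X p = coef0 X1 p - coef0 X2 p - coef0 X3 p - coef0 X4 p) *
  (coef1 X p = coef1 X1 p - coef1 X2 p - coef1 X3 p - coef1 X4 p) *
  (coef2 X p = coef2 X1 p - coef2 X2 p - coef2 X3 p - coef2 X4 p).
Proof. by rewrite /coef0 /coef1 /coef2 !(pi1D, pi1N) !(pi2D, pi2N) !mxE. Qed.

(** The curvature of the warped product of the line with the flat plane. The
    derivatives of the components of [Z] cancel: the first two terms of [RD]
    give the derivative along [bracket X Y], the third removes the derivative
    along its projection, and the fourth the derivative along the remaining
    part, whose components along the distribution are zero. *)
Lemma coef_RD X Y Z p : section D X -> section D Y -> section D Z ->
  (coef0 (RD f X Y Z) p =
     - (w p * w'' p) *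
     ((coef0 X p * coef1 Y p - coef0 Y p * coef1 X p) * coef1 Z p +
      (coef0 X p * coef2 Y p - coef0 Y p * coef2 X p) * coef2 Z p)) *
  (coef1 (RD f X Y Z) p =
     w'' p / w p * (coef0 X p * coef1 Y p - coef0 Y p * coef1 X p) * coef0 Z p
     - w' p * w' p *
       (coef1 X p * coef2 Y p - coef2 X p * coef1 Y p) * coef2 Z p) *
  (coef2 (RD f X Y Z) p =
     w'' p / w p * (coef0 X p * coef2 Y p - coef0 Y p * coef2 X p) * coef0 Z p
     + w' p * w' p *
       (coef1 X p * coef2 Y p - coef2 X p * coef1 Y p) * coef1 Z p).
Proof.
move=> DX DY DZ.
have [sX _] := DX; have [sY _] := DY; have [sZ _] := DZ.
have [x0 x1 x2] := And3 (smooth_coef0 sX) (smooth_coef1 sX) (smooth_coef2 sX).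
have [y0 y1 y2] := And3 (smooth_coef0 sY) (smooth_coef1 sY) (smooth_coef2 sY).
have [z0 z1 z2] := And3 (smooth_coef0 sZ) (smooth_coef1 sZ) (smooth_coef2 sZ).
have sw := smooth_warp hf; have sw' := smooth_warp' hf.
have sh := smooth_dlog_warp hf f_neq0.
have DYZ := section_nablaD DY DZ; have DXZ := section_nablaD DX DZ.
have sB := vector_field_bracket sX sY.
have DP := section_piD sB.
set B := bracket X Y in sB DP.
set N := piDperp f B.
have sN : vector_field N by apply: vector_fieldB => //; have [] := DP.
have N0 : (coef0 N = fun=> 0) * (coef1 N = fun=> 0) * (coef2 N = fun=> 0).
  by do ![split]; apply/funext => q; rewrite /N /piDperp coefB coef_piD// subrr.
have dirN phi : smooth phi -> dir N phi p =
    dir X (dir Y phi) p - dir Y (dir X phi) p - dir (piD f B) phi p.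
  by move=> sphi; rewrite dir_vecB// dir_bracket.
have RDE : (coef0 (RD f X Y Z) p = coef0 (nablaD f X (nablaD f Y Z)) p
    - coef0 (nablaD f Y (nablaD f X Z)) p - coef0 (nablaD f (piD f B) Z) p
    - coef0 (piD f (bracket N Z)) p) *
  (coef1 (RD f X Y Z) p = coef1 (nablaD f X (nablaD f Y Z)) p
    - coef1 (nablaD f Y (nablaD f X Z)) p - coef1 (nablaD f (piD f B) Z) p
    - coef1 (piD f (bracket N Z)) p) *
  (coef2 (RD f X Y Z) p = coef2 (nablaD f X (nablaD f Y Z)) p
    - coef2 (nablaD f Y (nablaD f X Z)) p - coef2 (nablaD f (piD f B) Z) p
    - coef2 (piD f (bracket N Z)) p).
  exact: (coef_subB (nablaD f X (nablaD f Y Z)) (nablaD f Y (nablaD f X Z))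
    (nablaD f (piD f B) Z) (piD f (bracket N Z)) p).
have dirs W V U : vector_field W -> section D V -> section D U ->
  (dir W (coef0 (nablaD f V U)) p = dir W (dir V (coef0 U)) p
   - (w' p * coef0 W p * w' p + w p * (w'' p * coef0 W p))
     * (coef1 V p * coef1 U p + coef2 V p * coef2 U p)
   - w p * w' p * (dir W (coef1 V) p * coef1 U p + coef1 V p * dir W (coef1 U) p
     + dir W (coef2 V) p * coef2 U p + coef2 V p * dir W (coef2 U) p)) *
  (dir W (coef1 (nablaD f V U)) p = dir W (dir V (coef1 U)) p
   + dir W h p * (coef0 V p * coef1 U p + coef1 V p * coef0 U p)
   + h p * (dir W (coef0 V) p * coef1 U p + coef0 V p * dir W (coef1 U) p
     + dir W (coef1 V) p * coef0 U p + coef1 V p * dir W (coef0 U) p)) *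
  (dir W (coef2 (nablaD f V U)) p = dir W (dir V (coef2 U)) p
   + dir W h p * (coef0 V p * coef2 U p + coef2 V p * coef0 U p)
   + h p * (dir W (coef0 V) p * coef2 U p + coef0 V p * dir W (coef2 U) p
     + dir W (coef2 V) p * coef0 U p + coef2 V p * dir W (coef0 U) p)).
  move=> sW DV DU; have [sV _] := DV; have [sU _] := DU.
  have [v0 v1 v2] := And3 (smooth_coef0 sV) (smooth_coef1 sV) (smooth_coef2 sV).
  have [u0 u1 u2] := And3 (smooth_coef0 sU) (smooth_coef1 sU) (smooth_coef2 sU).
  rewrite !(coef_nablaD DV DU); do ![split].
  - rewrite (dir_sub_bilinear W p (smooth_dir sV u0) sw sw' v1 v2 u1 u2).
    by rewrite dir_warp // dir_warp'.
  - by rewrite (dir_add_bilinear W p (smooth_dir sV u1) sh v0 v1 u1 u0).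
  - by rewrite (dir_add_bilinear W p (smooth_dir sV u2) sh v0 v2 u2 u0).
have nYZ := coef_nablaD DY DZ; have nXZ := coef_nablaD DX DZ.
have nBZ := coef_nablaD DP DZ.
have nXYZ := coef_nablaD DX DYZ; have nYXZ := coef_nablaD DY DXZ.
have dYZ := dirs X Y Z sX DY DZ; have dXZ := dirs Y X Z sY DX DZ.
have brs := coef_bracket p sX sY; have brN := coef_bracket p sN sZ.
have pB := coef_piD f_neq0 B p; have pN := coef_piD f_neq0 (bracket N Z) p.
have dN0 := dirN _ z0; have dN1 := dirN _ z1; have dN2 := dirN _ z2.
have dh V := dir_dlog_warp V p.
have dir0 W : dir W (fun=> 0) p = 0 :> R by exact: dir_cst.
have wn := warp_neq0 f_neq0 p.
rewrite -/B in brs.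
(* Only the values and derivatives of components matter from here on: all
   fields built from [X], [Y] and [Z] become variables. *)
clear dirs dirN DX DY DZ sB DP sN DYZ DXZ sX sY sZ.
clear x0 x1 x2 y0 y1 y2 z0 z1 z2 sw sw' sh.
clearbody N B.
move: RDE nYZ nXZ nBZ nXYZ nYXZ dYZ dXZ brs brN pB pN N0 dN0 dN1 dN2.
move: (RD f X Y Z) => RXYZ; move: (nablaD f X (nablaD f Y Z)) => XYZ.
move: (nablaD f Y (nablaD f X Z)) => YXZ; move: (nablaD f (piD f B) Z) => BZ.
move: (piD f (bracket N Z)) => PNZ; move: (bracket N Z) => NZ.
move: (nablaD f Y Z) => YZ; move: (nablaD f X Z) => XZ; move: (piD f B) => PB.
move=> RDE nYZ nXZ nBZ nXYZ nYXZ dYZ dXZ brs brN pB pN N0 dN0 dN1 dN2.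
rewrite !RDE !pN !brN !N0 !dir0 !subr0 !nXYZ !nYXZ !dYZ !dXZ !nYZ !nXZ !nBZ.
rewrite !pB !brs dN0 dN1 dN2 !dh /dlog_warp.
do ![split]; atomize p wn; field; exact: wn.
Qed.

End Curvature.

(** * Ricci curvature and the Einstein equations *)

Section Einstein.
Context {R : realType}.
Local Notation M := 'rV[R]_(1 + 3).
Context (f : R -> R) (hf : smooth1 f) (f_neq0 : forall t, f t != 0).
Implicit Types (p u v : M) (X Y Z : M -> M).
Local Notation w := (warp f).
Local Notation w' := (warp' f).
Local Notation w'' := (warp'' f).

Lemma sum_ord3 (F : 'I_3 -> R) : \sum_k F k = F 0 + F 1 + F 2.
Proof.
rewrite !big_ord_recl big_ord0 addr0 addrA.
by congr (F _ + F _ + F _); exact: val_inj.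
Qed.

(** A one-sided inverse of a square matrix is two-sided: if the rows are
    orthonormal, then so are the columns. *)
Lemma orthonormal_dual (a b c : 'I_3 -> R) :
  (forall i j, a i * a j + b i * b j + c i * c j = (i == j)%:R) ->
  (\sum_k a k * a k = 1) * (\sum_k a k * b k = 0) *
  (\sum_k a k * c k = 0) * (\sum_k b k * b k = 1) *
  (\sum_k b k * c k = 0) * (\sum_k c k * c k = 1).
Proof.
move=> on; pose Q : 'M[R]_3 := \matrix_(i, j) [:: a i; b i; c i]`_j.
have QQ : Q *m Q^T = 1%:M.
  by apply/matrixP => i j; rewrite !mxE sum_ord3 !mxE /= on.
have dual i j : \sum_k Q k i * Q k j = (i == j)%:R.
  have /matrixP/(_ i j) := mulmx1C QQ; rewrite !mxE => <-.
  by apply: eq_bigr => k _; rewrite [in RHS]mxE.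
have E0 k : Q k 0 = a k by rewrite mxE.
have E1 k : Q k 1 = b k by rewrite mxE.
have E2 k : Q k 2 = c k by rewrite mxE.
have d00 := dual 0 0; have d01 := dual 0 1; have d02 := dual 0 2.
have d11 := dual 1 1; have d12 := dual 1 2; have d22 := dual 2 2.
do ![split]; [rewrite -[RHS]d00|rewrite -[RHS]d01|rewrite -[RHS]d02
  |rewrite -[RHS]d11|rewrite -[RHS]d12|rewrite -[RHS]d22];
by apply: eq_bigr => k _; rewrite ?E0 ?E1 ?E2.
Qed.

(** The components of an orthonormal frame enter the sum only through the
    products of the columns of the matrix that they form, which
    [orthonormal_dual] evaluates; hence the result is the same for all frames.
    The components along [e1] and [e2] are multiplied by [w] to make them
    orthonormal coordinates. *)
Lemma RicDE E X Y p : orthonormal_frame f E -> section D X -> section D Y ->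
  RicD f E X Y p = 2 * (w'' p / w p) * (coef0 X p * coef0 Y p) +
    (w p * w'' p + w' p * w' p) *
      (coef1 X p * coef1 Y p + coef2 X p * coef2 Y p).
Proof.
move=> [DE on] DX DY.
pose a k := coef0 (E k) p; pose b k := w p * coef1 (E k) p.
pose c k := w p * coef2 (E k) p.
have wn := warp_neq0 f_neq0 p.
have [[[[[Saa Sab] Sac] Sbb] Sbc] Scc] :
  (\sum_k a k * a k = 1) * (\sum_k a k * b k = 0) *
  (\sum_k a k * c k = 0) * (\sum_k b k * b k = 1) *
  (\sum_k b k * c k = 0) * (\sum_k c k * c k = 1).
  apply: orthonormal_dual => i j; rewrite -(on p i j) gDE /a /b /c.
  by ring.
transitivity (\sum_k (
   - w'' p * coef0 X p * coef1 Y p * (a k * b k)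
   - w'' p * coef0 X p * coef2 Y p * (a k * c k)
   + w p * w'' p * (coef1 X p * coef1 Y p + coef2 X p * coef2 Y p) * (a k * a k)
   + w'' p / w p * coef0 X p * coef0 Y p * (b k * b k)
   + w'' p / w p * coef0 X p * coef0 Y p * (c k * c k)
   - w'' p * coef1 X p * coef0 Y p * (a k * b k)
   - w'' p * coef2 X p * coef0 Y p * (a k * c k)
   + w' p * w' p * (coef2 X p * coef2 Y p) * (b k * b k)
   + w' p * w' p * (coef1 X p * coef1 Y p) * (c k * c k)
   - w' p * w' p *
     (coef1 X p * coef2 Y p + coef2 X p * coef1 Y p) * (b k * c k))).
  apply: eq_bigr => k _.
  rewrite gDE !(coef_RD hf f_neq0 p DX (DE k) DY) /a /b /c.
  move: (coef0 (E k) p) (coef1 (E k) p) (coef2 (E k) p) => e0 e1 e2.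
  by atomize p wn; field; exact: wn.
rewrite !(big_split, sumrB, sumrN) /= -!mulr_sumr Saa Sab Sac Sbb Sbc Scc.
by atomize p wn; field; exact: wn.
Qed.

Definition adapted_frame (i : 'I_3) p : M := frame p (i == 0)%:R
  ((i == 1)%:R * (w p)^-1) ((i == 2)%:R * (w p)^-1) 0.

Lemma section_frame (a b c : M -> R) : smooth a -> smooth b -> smooth c ->
  section D (fun p => frame p (a p) (b p) (c p) 0).
Proof.
move=> sa sb sc; apply/sectionP; split.
  by apply: vector_field_frame (smooth_cst 0).
by apply/funext => p; rewrite (coef_frame a b c (fun=> 0)).
Qed.

Lemma adapted_frameP : orthonormal_frame f adapted_frame.
Proof.
split=> [k|p i j].
  have sc (b : bool) : smooth (fun p : M => b%:R * (w p)^-1).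
    by apply: smoothM; [exact: smooth_cst|exact: smooth_warpV].
  by apply: section_frame => //; exact: smooth_cst.
rewrite gDE /adapted_frame.
rewrite !(coef_frame (fun=> (i == 0)%:R) (fun p => (i == 1)%:R * (w p)^-1)
  (fun p => (i == 2)%:R * (w p)^-1) (fun=> 0)).
rewrite !(coef_frame (fun=> (j == 0)%:R) (fun p => (j == 1)%:R * (w p)^-1)
  (fun p => (j == 2)%:R * (w p)^-1) (fun=> 0)).
have wn := warp_neq0 f_neq0 p.
by case: i => [] [|[|[|//]]] hi; case: j => [] [|[|[|//]]] hj;
  rewrite /eq_op /=; field.
Qed.

(** The first equation is the condition on [partial_t], the second the one on
    [e1] and [e2]; mixed terms vanish. *)
Lemma einsteinP c0 : einstein f c0 <-> forall t,
  2 * derive1 (derive1 f) t = c0 * f t /\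
  f t * derive1 (derive1 f) t + derive1 f t * derive1 f t = c0 * (f t * f t).
Proof.
split=> [einst t|ode E onE X Y DX DY p].
  pose p : M := row_mx t%:M 0.
  have pt : pi1 p = t by rewrite pi1_row mxE mulr1n.
  pose T p : M := frame p 1 0 0 0; pose U p : M := frame p 0 1 0 0.
  have DT : section D T by apply: section_frame; exact: smooth_cst.
  have DU : section D U by apply: section_frame; exact: smooth_cst.
  have TE := coef_frame (fun=> 1) (fun=> 0) (fun=> 0) (fun=> 0) p.
  have UE := coef_frame (fun=> 0) (fun=> 1) (fun=> 0) (fun=> 0) p.
  have /= := einst _ adapted_frameP T T DT DT p.
  have /= := einst _ adapted_frameP U U DU DU p.
  rewrite !(RicDE p adapted_frameP) // !gDE /T /U !TE !UE.
  have wn := warp_neq0 f_neq0 p.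
  rewrite -pt -/(warp f p) -/(warp' f p) -/(warp'' f p).
  move: (warp'' _ p) (warp' _ p) (warp _ p) wn => w2 w1 w0 wn.
  rewrite !(mulr0, mul0r, mulr1, add0r, addr0) => <- <-; split; last by [].
  by field.
rewrite (RicDE p onE DX DY) gDE; have [] := ode (pi1 p).
rewrite -/(warp f p) -/(warp' f p) -/(warp'' f p) => o1 o2.
rewrite o2 (_ : 2 * (warp'' f p / warp f p) = c0); first by ring.
by rewrite mulrA o1 mulfK // (warp_neq0 f_neq0).
Qed.

Lemma is_derive_derive1 (g : R -> R) t : derivable g t 1 ->
  is_derive t (1 : R) g (derive1 g t).
Proof. by move=> dg; rewrite derive1E; exact: derivableP. Qed.

Lemma is_derive_expR_scale (k t : R) :
  is_derive t (1 : R) (fun x => expR (k * x)) (k * expR (k * t)).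
Proof.
rewrite [k * expR _]mulrC.
have dk : is_derive t (1 : R) (fun x : R => k * x) k.
  by apply: is_derive_eq; rewrite /GRing.scale /= mulr1.
exact: (is_derive1_comp (f := expR) (g := fun x : R => k * x)).
Qed.

(** The two equations together give [f'^2 = f f''], so that the logarithmic
    derivative [f' / f] is a constant [k], and then [c0 = 2 k^2]. A constant
    logarithmic derivative leaves only exponentials. *)
Lemma warp_ode c0 :
  (forall t, 2 * derive1 (derive1 f) t = c0 * f t /\
   f t * derive1 (derive1 f) t + derive1 f t * derive1 f t = c0 * (f t * f t))
  <-> exists k c : R, c0 = 2 * (k * k) /\ forall t, f t = c * expR (k * t).
Proof.
split=> [ode|[k [c [-> fE]]] t].
  have df t : is_derive t (1 : R) f (derive1 f t).
    exact: is_derive_derive1 (@hf 0%N t).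
  have df' t : is_derive t (1 : R) (derive1 f) (derive1 (derive1 f) t).
    exact: is_derive_derive1 (@hf 1%N t).
  have ode' t : 2 * (f t * derive1 (derive1 f) t) = c0 * (f t * f t).
    by rewrite mulrCA (ode t).1 mulrCA.
  pose g t := derive1 f t * (f t)^-1.
  have g0 t : g t = g 0.
    apply: is_derive_0_is_cst => x.
    have dV : is_derive x (1 : R) (fun y => (f y)^-1)
        (- (f x) ^- 2 *: derive1 f x).
      have [dx ex] := df x.
      apply: DeriveDef; first exact: derivableV.
      by rewrite (deriveV (f_neq0 x) dx) ex.
    have dM := is_deriveM (df' x) dV.
    apply: (is_derive_eq dM).
    have ode1 := ode' x; have [_ ode2] := ode x; have fx := f_neq0 x.
    rewrite /GRing.scale /= -exprVn expr2; apply: (mulfI fx); apply: (mulfI fx).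
    rewrite !mulr0 (_ : f x * (f x * _) =
        f x * derive1 (derive1 f) x - derive1 f x * derive1 f x).
      lra.
    clear ode1 ode2.
    by move: (f x) (derive1 f x) (derive1 (derive1 f) x) fx => ? ? ? ?; field.
  have f'E t : derive1 f t = g 0 * f t by rewrite -(g0 t) /g mulfVK.
  have E0 t : f t * expR (- g 0 * t) = f 0 * expR (- g 0 * 0).
    apply: (@is_derive_0_is_cst _ (fun t => f t * expR (- g 0 * t))) => x.
    have dM := is_deriveM (df x) (is_derive_expR_scale (- g 0) x).
    apply: (is_derive_eq dM).
    by rewrite f'E /GRing.scale /=; ring.
  exists (g 0), (f 0); split.
    have [_ o2] := ode 0; have o3 := ode' 0; have fx := f_neq0 0.
    rewrite f'E in o2; apply: (mulIf fx); apply: (mulIf fx).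
    by move: o2 o3; move: (derive1 (derive1 f) 0) (g 0) (f 0) => a b d; lra.
  move=> t; have := E0 t; rewrite mulr0 expR0 mulr1 => <-.
  by rewrite -mulrA -expRD mulNr addNr expR0 mulr1.
have dE b :
    derive1 (fun x => b * expR (k * x)) = fun x => (k * b) * expR (k * x).
  apply/funext => x; rewrite derive1E.
  have d := is_deriveM (is_derive_cst b x 1) (is_derive_expR_scale k x).
  have [_ ->] := d.
  by rewrite /GRing.scale /=; ring.
have -> : f = fun x => c * expR (k * x) by apply/funext.
by rewrite !dE; split; ring.
Qed.

End Einstein.

Theorem theorem5p3 (R : realType) (f : R -> R) (c0 : R)
    (hf : smooth1 f) (f_neq0 : forall t, f t != 0) :
  einstein f c0 <->
  exists c1 c2 : R,
    (c0 = 0 /\ forall t, f t = c1) \/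
    (0 < c0 /\
     ((forall t, f t = c1 * expR (Num.sqrt (c0 / 2) * t)) \/
      (forall t, f t = c2 * expR (- Num.sqrt (c0 / 2) * t)))).
Proof.
rewrite einsteinP // warp_ode //; split=> [[k [c [c0E fE]]]|[c1 [c2]]].
  (* The sign of [k] selects the case: [k] is plus or minus [sqrt (c0 / 2)]. *)
  exists c, c; have [k0|k0|k0] := ltgtP k 0.
  - right; split; first by rewrite c0E; nra.
    right => t; rewrite fE (_ : c0 / 2 = k ^+ 2);
      last by rewrite c0E expr2; field.
    by rewrite sqrtr_sqr ltr0_norm // opprK.
  - right; split; first by rewrite c0E; nra.
    left => t; rewrite fE (_ : c0 / 2 = k ^+ 2);
      last by rewrite c0E expr2; field.
    by rewrite sqrtr_sqr gtr0_norm.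
  - left; split; first by rewrite c0E k0 !mulr0.
    by move=> t; rewrite fE k0 mul0r expR0 mulr1.
case=> [[-> fE]|[c0_gt0 fE]].
  by exists 0, c1; split=> [|t]; rewrite ?mulr0// fE mul0r expR0 mulr1.
have sq : c0 = 2 * (Num.sqrt (c0 / 2) * Num.sqrt (c0 / 2)).
  by rewrite -expr2 sqr_sqrtr; [field|rewrite divr_ge0// ltW].
case: fE => fE; first by exists (Num.sqrt (c0 / 2)), c1.
by exists (- Num.sqrt (c0 / 2)), c2; split; rewrite ?mulrNN.
Qed.
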